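(* For every locally compact Polish space $X$ having more than two points the set of all metrics $d \in \operatorname{Metr}_c(X)$ for which $\operatorname{Iso}(X,d) = \{\operatorname{id}_X\}$ is dense (in the topology of uniform convergence on compact subsets of $X \times X$) in $\operatorname{Metr}_c(X)$.
   Context: A space is Polish if it is separable and completely metrizable. A metric is proper if all closed balls with respect to it are compact. $\operatorname{Metr}_c(X)$ is the set of all proper metrics on $X$ inducing the topology of $X$. $\operatorname{Iso}(X,d)$ is the group of all bijective isometries of $(X,d)$; $\operatorname{id}_X$ is the identity map. *)

(* Defs.v *)
From HB Require Import structures.
From mathcomp Require Import all_boot all_order all_algebra.
From mathcomp Require Import all_classical all_reals all_analysis.

Set Implicit Arguments.
Unset Strict Implicit.
Unset Printing Implicit Defensive.

Import Order.TTheory GRing.Theory Num.Theory.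
Import numFieldNormedType.Exports.

Local Open Scope classical_set_scope.
Local Open Scope ring_scope.

(* The metric structures of the library attach one distance to a type.  Here
   many metrics on the same space are compared, so a metric is a function on
   X * X and its properties are predicates. *)

Definition is_metric (R : realType) (X : Type) (d : X * X -> R) : Prop :=
  [/\ forall x y, 0 <= d (x, y),
      forall x y, d (x, y) = 0 <-> x = y,
      forall x y, d (x, y) = d (y, x) &
      forall x y z, d (x, z) <= d (x, y) + d (y, z)].

Definition induces_topology (R : realType) (X : topologicalType)
    (d : X * X -> R) : Prop :=
  forall U : set X, open U <->
    forall x, U x -> exists2 e : R, 0 < e & [set y | d (x, y) < e] `<=` U.

Definition complete_metric (R : realType) (X : Type) (d : X * X -> R) : Prop :=
  forall u : nat -> X,
    (forall e : R, 0 < e -> exists N : nat, forall m n : nat,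
       (N <= m)%N -> (N <= n)%N -> d (u m, u n) < e) ->
    exists l : X, forall e : R, 0 < e -> exists N : nat, forall n : nat,
       (N <= n)%N -> d (u n, l) < e.

Definition separable_space (X : topologicalType) : Prop :=
  exists2 D : set X, countable D & dense D.

Definition completely_metrizable (R : realType) (X : topologicalType) : Prop :=
  exists d : X * X -> R,
    [/\ is_metric d, induces_topology d & complete_metric d].

Definition polish_space (R : realType) (X : topologicalType) : Prop :=
  separable_space X /\ completely_metrizable R X.

(* Compactness refers to the topology of X; proper_metric is only used for
   metrics inducing that topology. *)
Definition proper_metric (R : realType) (X : topologicalType)
    (d : X * X -> R) : Prop :=
  forall (x : X) (r : R), compact [set y | d (x, y) <= r].

(* As a set in {family compact, X * X -> R}, Metr_c carries the topology of
   uniform convergence on compact subsets of X * X. *)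
Definition Metr_c (R : realType) (X : topologicalType) :
    set {family compact, (X * X)%type -> R} :=
  [set d : X * X -> R |
     [/\ is_metric d, induces_topology d & proper_metric d]].

Arguments Metr_c : clear implicits.

Definition Iso (R : realType) (X : Type) (d : X * X -> R) : set (X -> X) :=
  [set f | bijective f /\ forall x y, d (f x, f y) = d (x, y)].

(* Main.v *)
(* Given a proper metric d, look for a rigid one of the form
   d_f(x, y) = d(x, y) + |f x - f y| with f continuous and uniformly small; every
   such d_f is proper and induces the same topology.  For f generic in the sense
   of Baire, (1) d_f has a local maximum (a, b) in every product U * V of disjoint
   nonempty open sets, and (2) two local maxima of d_f with the same value are the
   same unordered pair.  An isometry g of d_f maps a local maximum (a, b) to a
   local maximum with the same value, hence {g a, g b} = {a, b}.  If g x <> x,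
   take a third point y outside {x, g x} and a local maximum (a, b) close to
   (x, y): then g a, being close to g x, is neither a nor b, a contradiction. *)

Require Import Defs.
From HB Require Import structures.
From mathcomp Require Import all_boot all_order all_algebra.
From mathcomp Require Import all_classical all_reals all_analysis.
From mathcomp Require Import lra.

Set Implicit Arguments.
Unset Strict Implicit.
Unset Printing Implicit Defensive.

Import Order.TTheory GRing.Theory Num.Theory.
Import numFieldNormedType.Exports.

Local Open Scope classical_set_scope.
Local Open Scope ring_scope.

(** * Baire category for uniform perturbations *)

(** Stands for containing a dense open set of continuous functions in the uniform distance. As [h]
    ranges over all functions, no continuity has to be checked to place a limit in the ball. *)
Definition robustly_dense (R : realType) (X : topologicalType)
    (Q : set (X -> R)) : Prop :=
  forall (f : X -> R) (e : R), continuous f -> 0 < e ->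
  exists g : X -> R, [/\ continuous g, forall x, `|g x - f x| <= e &
    exists2 t : R, 0 < t &
      forall h : X -> R, (forall x, `|h x - g x| <= t) -> Q h].

(** Baire's argument with nested closed balls, starting from the ball of radius [e] around 0. *)
Lemma robustly_dense_bigcap (R : realType) (X : topologicalType)
    (Q : nat -> set (X -> R)) (e : R) :
  (forall i, robustly_dense (Q i)) -> 0 < e ->
  exists f : X -> R,
    [/\ continuous f, forall x, `|f x| <= e & forall i, Q i f].
Proof.
move=> Qd e0.
(* [s] is a ball, given by centre and radius. Moving the centre by at most half the radius and
   halving the radius keeps the new ball inside the old one. The assumptions on [s] come after the
   quantifier so that [choice] yields a total function. *)
have step n (s : (X -> R) * R) : exists s' : (X -> R) * R,
    continuous s.1 -> 0 < s.2 -> [/\ continuous s'.1, 0 < s'.2,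
      s'.2 <= s.2 / 2, forall x, `|s'.1 x - s.1 x| <= s.2 / 2 &
      forall h, (forall x, `|h x - s'.1 x| <= s'.2) -> Q n h].
  have [[fc s0]|nP] := pselect (continuous s.1 /\ 0 < s.2); last first.
    by exists s => fc s0; case: nP.
  have /(Qd n s.1)[//|g [gc gs [t t0 gQ]]] : 0 < s.2 / 2 by lra.
  exists (g, Num.min (s.2 / 2) t) => _ _ /=; split => //.
  - by rewrite lt_min t0 andbT; lra.
  - by rewrite ge_min lexx.
  - by move=> h hg; apply: gQ => x; apply: le_trans (hg x) _; rewrite ge_min lexx orbT.
have [nxt nxtP] := choice (fun p => step p.1 p.2).
pose s := fix s n := if n is m.+1 then nxt (m, s m) else (cst 0 : X -> R, e).
have sP n : continuous (s n).1 /\ 0 < (s n).2.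
  elim: n => [|n [cn n0]]; first by split => //= x; exact: cvg_cst.
  by have [] := nxtP (n, s n) cn n0.
have sS n : [/\ (s n.+1).2 <= (s n).2 / 2,
    forall x, `|(s n.+1).1 x - (s n).1 x| <= (s n).2 / 2 &
    forall h, (forall x, `|h x - (s n.+1).1 x| <= (s n.+1).2) -> Q n h].
  by have [cn n0] := sP n; have [_ _ ? ? ?] := nxtP (n, s n) cn n0; split.
have sle n k x : `|(s (n + k)%N).1 x - (s n).1 x| + (s (n + k)%N).2 <= (s n).2.
  elim: k => [|k IH]; first by rewrite addn0 subrr normr0 add0r.
  apply: le_trans IH; rewrite addnS; have [e1 e2 _] := sS (n + k)%N.
  have := ler_normD ((s (n + k).+1).1 x - (s (n + k)%N).1 x)
    ((s (n + k)%N).1 x - (s n).1 x).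
  rewrite addrA subrK; have := e2 x; lra.
have s_small n : (s n).2 <= e / 2 ^+ n.
  elim: n => [|n IH]; first by rewrite expr0 divr1.
  have [e1 _ _] := sS n; apply: (le_trans e1).
  by rewrite exprSr invfM mulrA ler_pM2r ?invr_gt0.
have cross n m x : (s n).1 x - (s n).2 <= (s m).1 x + (s m).2.
  have [nm|/ltnW mn] := leqP n m.
    have := sle n (m - n)%N x; rewrite subnKC // => h.
    have := ler_norm ((s n).1 x - (s m).1 x); rewrite distrC.
    have := (sP m).2; lra.
  have := sle m (n - m)%N x; rewrite subnKC // => h.
  have := ler_norm ((s n).1 x - (s m).1 x).
  have := (sP n).2; lra.
(* The closed balls of radius (s n).2 around (s n).1 are nested; F is their common point. *)
pose F x := sup [set (s n).1 x - (s n).2 | n in [set: nat]].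
have Fs n x : `|F x - (s n).1 x| <= (s n).2.
  have F1 : (s n).1 x - (s n).2 <= F x.
    apply: sup_upper_bound; last by exists n.
    split; first by exists ((s n).1 x - (s n).2), n.
    by exists ((s n).1 x + (s n).2) => _ [m _ <-]; exact: cross.
  have F2 : F x <= (s n).1 x + (s n).2.
    apply: ge_sup; first by exists ((s n).1 x - (s n).2), n.
    by move=> _ [m _ <-]; exact: cross.
  by rewrite ler_norml; lra.
exists F; split.
- move=> x; apply/cvgrPdist_lt => t t0.
  have [n nt] : exists n, (s n).2 < t / 4.
    have t4 : 0 < t / 4 / e by rewrite divr_gt0 //; lra.
    have [N _ /(_ N (leqnn N)) hN] := near_infty_natSinv_expn_lt (PosNum t4).
    exists N; apply: le_lt_trans (s_small N) _.
    by move: hN; rewrite /= div1r ltr_pdivlMr // mulrC.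
  have /cvgrPdist_lt /(_ (t / 4)) := (sP n).1 x.
  have t4 : 0 < t / 4 by lra.
  move=> /(_ t4); apply: filterS => y xy.
  have := Fs n x; have := Fs n y; move: xy.
  rewrite !ltr_norml !ler_norml; lra.
- by move=> x; have := Fs 0%N x; rewrite /= subr0.
- by move=> i; have [_ _] := sS i; apply; exact: Fs.
Qed.

Lemma robustly_dense_bigcap_countable (R : realType) (X : topologicalType)
    (I : countType) (Q : I -> set (X -> R)) (e : R) :
  (forall i, robustly_dense (Q i)) -> 0 < e ->
  exists f : X -> R,
    [/\ continuous f, forall x, `|f x| <= e & forall i, Q i f].
Proof.
move=> Qd e0.
pose Q' n := if unpickle n is Some i then Q i else setT.
have [n|f [fc fe fQ]] := @robustly_dense_bigcap R X Q' e _ e0.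
  rewrite /Q'; case: unpickle => [i|]; first exact: Qd.
  move=> f t fc t0; exists f; split => // [x|]; first by rewrite subrr normr0 ltW.
  by exists t.
by exists f; split => // i; have := fQ (pickle i); rewrite /Q' pickleK.
Qed.

(** * The perturbed metrics *)

Section Perturbation.
Context (R : realType) (X : topologicalType) (d : X * X -> R).
Hypotheses (dm : is_metric d) (dtop : induces_topology d).
Implicit Types (f g h : X -> R) (a b c x y z : X) (r s t e : R).

Let d_ge0 x y : 0 <= d (x, y). Proof. by case: dm. Qed.
Let dxx x : d (x, x) = 0. Proof. by case: dm => _ d0 _ _; apply/d0. Qed.
Let dC x y : d (x, y) = d (y, x). Proof. by case: dm. Qed.
Let d_tri y x z : d (x, z) <= d (x, y) + d (y, z). Proof. by case: dm. Qed.

Let d_gt0 x y : x <> y -> 0 < d (x, y).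
Proof.
case: dm => _ d0 _ _ xy; rewrite lt_neqAle d_ge0 andbT eq_sym.
by apply/eqP => /d0.
Qed.

Lemma nbhs_metricP x (A : set X) :
  nbhs x A <-> exists2 e, 0 < e & [set y | d (x, y) < e] `<=` A.
Proof.
rewrite nbhsE /=; split => [[U [oU Ux] UA]|[e e0 eA]].
  by have [e e0 eU] := (dtop U).1 oU x Ux; exists e => // y /eU /UA.
exists [set y | d (x, y) < e]; last exact: eA.
split; last by rewrite /= dxx.
apply/dtop => y /= xy; exists (e - d (x, y)); first by lra.
by move=> z /= yz; have := d_tri y x z; lra.
Qed.

Lemma continuous_metric : continuous (d : X * X -> R).
Proof.
move=> [x y]; apply/cvgrPdist_lt => e e0.
have e2 : 0 < e / 2 by lra.
have xe : nbhs x [set x' | d (x, x') < e / 2] by apply/nbhs_metricP; exists (e / 2).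
have ye : nbhs y [set y' | d (y, y') < e / 2] by apply/nbhs_metricP; exists (e / 2).
exists ([set x' | d (x, x') < e / 2], [set y' | d (y, y') < e / 2]) => //.
move=> [x' y'] [/= xx' yy'].
have := d_tri x' x y; have := d_tri y' x' y; have := d_tri x x' y'.
have := d_tri y x y'; rewrite (dC x' x) (dC y' y) ltr_norml; lra.
Qed.

Definition perturb f (p : X * X) : R := d p + `|f p.1 - f p.2|.

Lemma continuous_perturb f : continuous f -> continuous (perturb f).
Proof.
move=> fc p; apply: cvgD; first exact: continuous_metric.
apply: cvg_norm; apply: cvgB; apply: continuous_comp.
- exact: cvg_fst.
- exact: fc.
- exact: cvg_snd.
- exact: fc.
Qed.

Lemma perturb_ge f p : d p <= perturb f p.
Proof. by rewrite lerDl. Qed.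

Lemma dist_perturb f g t p : (forall x, `|f x - g x| <= t) ->
  `|perturb f p - perturb g p| <= 2 * t.
Proof.
move=> fg; rewrite /perturb opprD addrACA subrr add0r.
apply: le_trans (ler_dist_dist _ _) _.
rewrite (_ : f p.1 - f p.2 - (g p.1 - g p.2) = f p.1 - g p.1 - (f p.2 - g p.2)).
  apply: le_trans (ler_normB _ _) _.
  by have := fg p.1; have := fg p.2; lra.
lra.
Qed.

Lemma perturb_metric f : is_metric (perturb f).
Proof.
split; rewrite /perturb /=.
- by move=> x y; rewrite addr_ge0.
- case: dm => _ d0 _ _ x y; split => [|->]; last by rewrite dxx subrr normr0 addr0.
  move=> xy; apply/d0; have := d_ge0 x y; have := normr_ge0 (f x - f y); lra.
- by move=> x y; rewrite dC distrC.
- move=> x y z; have := d_tri y x z.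
  by have := ler_distD (f y) (f x) (f z); lra.
Qed.

Lemma perturb_small f x r : continuous f -> 0 < r ->
  exists2 s, 0 < s & forall y, d (x, y) < s -> perturb f (x, y) < r.
Proof.
move=> fc r0; have r2 : 0 < r / 2 by lra.
have /cvgrPdist_lt /(_ _ r2) /nbhs_metricP [s s0 sf] := fc x.
exists (Num.min s (r / 2)); first by rewrite lt_min s0.
move=> y; rewrite lt_min => /andP[/sf/= fxy xy].
by rewrite /perturb /=; lra.
Qed.

Lemma perturb_topology f : continuous f -> induces_topology (perturb f).
Proof.
move=> fc U; split => [/dtop oU x Ux|oU].
  have [e e0 eU] := oU x Ux; exists e => // y /= xy; apply: eU => /=.
  by apply: le_lt_trans xy; exact: perturb_ge.
apply/dtop => x Ux; have [e e0 eU] := oU x Ux.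
have [s s0 sU] := perturb_small x fc e0.
by exists s => // y /= /sU /eU.
Qed.

Lemma closed_perturb_ball f x r : continuous f ->
  closed [set y | perturb f (x, y) <= r].
Proof.
move=> fc; apply: (@preimage_closed _ _ (fun y => perturb f (x, y)) [set u | u <= r]).
  move=> y _; apply: (@continuous_comp _ _ _ (pair x)).
    by apply: cvg_pair => //=; exact: cvg_cst.
  exact: continuous_perturb.
exact: closed_le.
Qed.

Lemma perturb_proper f : continuous f -> proper_metric d ->
  proper_metric (perturb f).
Proof.
move=> fc dp x r; apply: subclosed_compact (dp x r) _.
  exact: closed_perturb_ball.
by move=> y /=; apply: le_trans; exact: perturb_ge.
Qed.

(** * Spikes and generic local maxima *)

Definition bump a s x : R := Num.max 0 (1 - d (a, x) / s).

Lemma bump_itv a s x : 0 < s -> 0 <= bump a s x <= 1.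
Proof.
move=> s0; rewrite /bump le_max lexx /= ge_max ler01 /=.
by rewrite lerBlDr lerDl divr_ge0 // ltW.
Qed.

Lemma bump1 a s : bump a s a = 1.
Proof. by rewrite /bump dxx mul0r subr0; apply/max_idPr. Qed.

Lemma bump0 a s x : 0 < s -> s <= d (a, x) -> bump a s x = 0.
Proof. by move=> s0 sx; apply/max_idPl; rewrite subr_le0 ler_pdivlMr ?mul1r. Qed.

Lemma continuous_bump a s : continuous (bump a s).
Proof.
move=> x; apply: (@continuous_max R X (cst 0) (fun x => 1 - d (a, x) / s)).
  exact: cvg_cst.
apply: cvgB; first exact: cvg_cst.
apply: cvgMl; apply: (@continuous_comp _ _ _ (pair a)).
  by apply: cvg_pair => //=; exact: cvg_cst.
exact: continuous_metric.
Qed.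

Lemma continuous_addZ f g (k : R) : continuous f -> continuous g ->
  continuous (fun x => f x + k * g x).
Proof. by move=> fc gc x; apply: cvgD; [exact: fc|apply: cvgMr; exact: gc]. Qed.

(** The radius is measured in [D] itself, so that isometries of [D] preserve the notion with the
    same [r]. *)
Definition local_max (D : X * X -> R) a b r : Prop :=
  forall x y, D (a, x) < r -> D (b, y) < r -> D (x, y) <= D (a, b).

Lemma local_max_iso (D : X * X -> R) (g : X -> X) a b r :
  Iso D g -> local_max D a b r -> local_max D (g a) (g b) r.
Proof.
move=> [[k gK kK] gD] m x y; rewrite -(kK x) -(kK y) !gD; exact: m.
Qed.

(** A form of having a local maximum near [(a, b)] that survives small changes of [f]: the centre
    beats the outer shell of a product of balls, so the maximum over the product is attained off the
    shell. *)
Definition strict_max_near a b r f : Prop := a <> b ->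
  exists2 s, 0 < s <= r & forall x y, d (a, x) <= s -> d (b, y) <= s ->
    s / 2 <= d (a, x) \/ s / 2 <= d (b, y) -> perturb f (x, y) < perturb f (a, b).

(** At [u = 0] the usual sign is 0, which would erase a spike; here [k] is 1 there. *)
Lemma sign_norm (u : R) : exists k : R, [/\ `|k| = 1, k * k = 1 & k * u = `|u|].
Proof.
case: (ger0P u) => _; first by exists 1; rewrite normr1 !mul1r.
by exists (-1); rewrite normrN1 !mulN1r opprK.
Qed.

Lemma strict_max_near_dense a b r : 0 < r ->
  robustly_dense (strict_max_near a b r).
Proof.
move=> r0 f e fc e0.
have [->|/eqP ab] := eqVneq a b.
  exists f; split => // [x|]; first by rewrite subrr normr0 ltW.
  by exists 1 => // h _ bb; case: (bb erefl).
have e4 : 0 < e / 4 by lra.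
have dab := d_gt0 ab.
(* The bound [4 * s <= d (a, b)] keeps the spike at each point away from the [s]-ball of the
   other. *)
have [s [s0 sr sab sP]] : exists s, [/\ 0 < s, s <= r, 4 * s <= d (a, b) &
    forall x y, d (a, x) <= s -> d (b, y) <= s ->
      perturb f (x, y) < perturb f (a, b) + e / 4].
  have /cvgrPdist_lt /(_ _ e4) := @continuous_perturb f fc (a, b).
  case=> [[U V] [/= /nbhs_metricP[s1 s10 s1U] /nbhs_metricP[s2 s20 s2V]]] UV.
  pose m := Num.min (Num.min s1 s2) (Num.min r (d (a, b))).
  have m0 : 0 < m by rewrite !lt_min s10 s20 r0.
  have [ms1 ms2 mr mab] : [/\ m <= s1, m <= s2, m <= r & m <= d (a, b)].
    by rewrite /m !ge_min !lexx !orbT.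
  exists (m / 4); split; [lra|lra|lra|] => x y ax byy.
  have /UV /= : (U `*` V) (x, y) by split; [apply: s1U|apply: s2V] => /=; lra.
  by rewrite ltr_norml; lra.
have [k [k1 kk kab]] := sign_norm (f a - f b).
(* Opposite spikes at a and b raise d_f(a, b) by 2e, but d_f(x, y) by at most e
   as soon as x or y lies off its spike. *)
pose u x := bump a (s / 2) x - bump b (s / 2) x.
have s2 : 0 < s / 2 by lra.
have uc : continuous u.
  by move=> x; apply: cvgB; exact: continuous_bump.
have u1 x : `|u x| <= 1.
  have := bump_itv a x s2; have := bump_itv b x s2.
  by rewrite /u ler_norml; lra.
pose g x := f x + (k * e) * u x.
exists g; split.
- exact: continuous_addZ.
- move=> x; rewrite /g addrC addKr !normrM k1 mul1r (gtr0_norm e0).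
  by rewrite ler_piMr // ltW.
(* The centre leads the shell by more than 2e - e - e/4 = 3e/4 under [g]; passing to [h] moves each
   value by at most e/4. *)
exists (e / 8); first by lra.
move=> h hg _; exists s; first by rewrite s0.
move=> x y ax byy xy.
have := dist_perturb (x, y) hg; have := dist_perturb (a, b) hg.
have gab : perturb g (a, b) = perturb f (a, b) + 2 * e.
  rewrite /perturb /g /u /= !bump1 !bump0 ?(dC b a)//; try lra.
  rewrite (_ : _ - _ = k * (`|f a - f b| + 2 * e)); last first.
    rewrite -kab (_ : k * (_ + _) = (k * k) * (f a - f b) + 2 * (k * e)); last lra.
    by rewrite kk; lra.
  by rewrite normrM k1 mul1r ger0_norm ?addr_ge0//; lra.
have gxy : perturb g (x, y) <= perturb f (x, y) + e.
  have uxy : `|u x - u y| <= 1.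
    have ay : s / 2 <= d (a, y) by have := d_tri y a b; rewrite (dC y b); lra.
    have bx : s / 2 <= d (b, x) by have := d_tri x a b; rewrite (dC x b); lra.
    rewrite /u (bump0 s2 ay) (bump0 s2 bx).
    have := bump_itv a x s2; have := bump_itv b y s2; rewrite ler_norml.
    by case: xy => /(bump0 s2) ->; lra.
  rewrite /perturb /g /= -[leRHS]addrA lerD2l.
  rewrite (_ : _ - _ = (f x - f y) + (k * e) * (u x - u y)); last by lra.
  apply: le_trans (ler_normD _ _) _; rewrite lerD2l !normrM k1 mul1r gtr0_norm //.
  by rewrite ler_piMr // ltW.
have := sP x y ax byy; rewrite !ler_norml; lra.
Qed.

(* The maxima of d_f over the two products of closed balls differ; this is phrased
   without suprema. *)
Definition separated_max a b a' b' r f : Prop :=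
  3 * r < d (a, b) -> 3 * r < d (a, a') -> 3 * r < d (a, b') ->
  (exists x y, [/\ d (a, x) <= r, d (b, y) <= r & forall x' y',
     d (a', x') <= r -> d (b', y') <= r -> perturb f (x', y') < perturb f (x, y)]) \/
  (exists x' y', [/\ d (a', x') <= r, d (b', y') <= r & forall x y,
     d (a, x) <= r -> d (b, y) <= r -> perturb f (x, y) < perturb f (x', y')]).

Hypothesis dp : proper_metric d.

Lemma perturb_max f a b r : continuous f -> 0 < r ->
  exists x y, [/\ d (a, x) <= r, d (b, y) <= r & forall x' y',
    d (a, x') <= r -> d (b, y') <= r -> perturb f (x', y') <= perturb f (x, y)].
Proof.
move=> fc r0.
have /compact_EVT_max : [set x | d (a, x) <= r] `*` [set y | d (b, y) <= r] !=set0.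
  by exists (a, b); split => /=; rewrite dxx ltW.
move=> /(_ R (perturb f)) []; first exact: compact_setX.
  by apply: continuous_subspaceT; exact: continuous_perturb.
move=> [x y]; rewrite inE => -[/= ax byy] xyP; exists x, y; split => // x' y' ax' by'.
by apply: (xyP (x', y')); rewrite inE.
Qed.

(** Either the maximum over the second product already leads by e/2, or a spike of height e puts the
    first one ahead by more than e/2. One spike suffices, hence only the ball of [a] has to be far
    from the other three. With tolerance e/16 each value moves by at most e/8. *)
Lemma separated_max_dense a b a' b' r : 0 < r ->
  robustly_dense (separated_max a b a' b' r).
Proof.
move=> r0 f e fc e0.
have e16 : 0 < e / 16 by lra.
have [x [y [ax byy xyP]]] := perturb_max a b fc r0.
have [[x' [y' [ax' by' gt]]]|nle] := pselect (exists x' y',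
    [/\ d (a', x') <= r, d (b', y') <= r &
     perturb f (x, y) + e / 2 <= perturb f (x', y')]).
  exists f; split => // [z|]; first by rewrite subrr normr0 ltW.
  exists (e / 16) => // h hf _ _ _; right; exists x', y'; split => // x1 y1 ax1 by1.
  have := dist_perturb (x1, y1) hf; have := dist_perturb (x', y') hf.
  by have := xyP _ _ ax1 by1; rewrite !ler_norml; lra.
have [k [k1 kk kxy]] := sign_norm (f x - f y).
(* A spike at x raises d_f(x, y) and leaves d_f unchanged around (a', b'). *)
pose g z := f z + (k * e) * bump x r z.
exists g; split.
- by apply: continuous_addZ => //; exact: continuous_bump.
- move=> z; rewrite /g addrC addKr !normrM k1 mul1r (gtr0_norm e0).
  have /andP[? ?] := bump_itv x z r0.
  by rewrite (ger0_norm (x := bump x r z)) // ler_piMr // ltW.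
exists (e / 16) => // h hg ab aa ab'; left; exists x, y; split => // x' y' ax' by'.
(* Here [x] and [z] are within [r] of [a] and [c], so [3 * r < d (a, c)] leaves more than [r]
   between them. *)
have far c z : 3 * r < d (a, c) -> d (c, z) <= r -> bump x r z = 0.
  move=> ac cz; apply: bump0 => //.
  by have := d_tri x a c; have := d_tri z x c; rewrite (dC z c); lra.
have gxy : perturb g (x, y) = perturb f (x, y) + e.
  rewrite /perturb /g /= bump1 (far b y) // mulr0 mulr1 addr0.
  rewrite (_ : _ - _ = k * (`|f x - f y| + e)); last first.
    rewrite -kxy (_ : k * (_ + _) = (k * k) * (f x - f y) + k * e); last lra.
    by rewrite kk; lra.
  by rewrite normrM k1 mul1r ger0_norm ?addr_ge0//; lra.
have gxy' : perturb g (x', y') = perturb f (x', y').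
  by rewrite /perturb /g /= (far a' x') // (far b' y') // mulr0 !addr0.
have lt : perturb f (x', y') < perturb f (x, y) + e / 2.
  by rewrite ltNge; apply/negP => le; apply: nle; exists x', y'.
have := dist_perturb (x', y') hg; have := dist_perturb (x, y) hg.
by rewrite !ler_norml; lra.
Qed.

(** Converts the radius from the perturbed metric to [d], in which the balls of [separated_max] are
    measured. *)
Lemma local_max_metric f a b r : continuous f -> 0 < r ->
  local_max (perturb f) a b r -> exists2 s, 0 < s &
  forall x y, d (a, x) <= s -> d (b, y) <= s -> perturb f (x, y) <= perturb f (a, b).
Proof.
move=> fc r0 m.
have [s s0 sP] := perturb_small a fc r0; have [t t0 tP] := perturb_small b fc r0.
exists (Num.min s t / 2); first by rewrite divr_gt0 // lt_min s0.
move=> x y ax byy; have st : 0 < Num.min s t by rewrite lt_min s0.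
have [? ?] : Num.min s t <= s /\ Num.min s t <= t by rewrite !ge_min !lexx orbT.
by apply: m; [apply: sP|apply: tP]; lra.
Qed.

(** A maximizer over the closed [s]-balls lies in the open half-balls. Since [d] is below the
    perturbed metric, perturbed balls of radius s/2 around it stay in the [s]-balls. *)
Lemma strict_max_local_max f a b r : continuous f -> a <> b ->
  strict_max_near a b r f ->
  exists a' b' s, [/\ d (a, a') < r, d (b, b') < r, 0 < s &
    local_max (perturb f) a' b' s].
Proof.
move=> fc ab /(_ ab)[s /andP[s0 sr] sP].
have [x [y [ax byy xyP]]] := perturb_max a b fc s0.
have ins : d (a, x) < s / 2 /\ d (b, y) < s / 2.
  have mab : perturb f (a, b) <= perturb f (x, y) by apply: xyP; rewrite dxx ltW.
  by split; rewrite ltNge; apply/negP => le;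
    have := sP x y ax byy; (move=> /(_ (or_introl le)) || move=> /(_ (or_intror le)));
    lra.
case: ins => ax2 by2; exists x, y, (s / 2); split; [lra|lra|lra|].
move=> x' y' xx' yy'; apply: xyP.
  by have := perturb_ge f (x, x'); have := d_tri x a x'; lra.
by have := perturb_ge f (y, y'); have := d_tri y b y'; lra.
Qed.

End Perturbation.

(** * Rigidity of a generic perturbation *)

Lemma separable_seq (X : topologicalType) (x0 : X) : separable_space X ->
  exists u : nat -> X, forall O, O !=set0 -> open O -> exists n, O (u n).
Proof.
move=> [D /countable_injP[i iinj] Dd].
(* [x0] is the value at numbers that code no point of [D]. *)
have inv n : exists x, forall z, D z -> i z = n -> D x /\ i x = n.
  have [[z [Dz iz]]|nz] := pselect (exists z, D z /\ i z = n).
    by exists z.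
  by exists x0 => z Dz iz; case: nz; exists z.
have [u uP] := choice inv.
exists u => O O0 oO; have [z [Oz Dz]] := Dd O O0 oO.
have [Du iu] := uP _ _ Dz erefl.
by exists (i z); rewrite (iinj _ _ _ _ iu) ?inE.
Qed.

Lemma rigid_perturbation (R : realType) (X : topologicalType)
    (d : X * X -> R) (e : R) :
  is_metric d -> induces_topology d -> proper_metric d -> separable_space X ->
  (exists x y z : X, [/\ x != y, x != z & y != z]) -> 0 < e ->
  exists f : X -> R, [/\ continuous f, forall x, `|f x| <= e &
    Iso (perturb d f) = [set idfun]].
Proof.
move=> dm dtop dp Xsep X3 e0; have [x0 _] := X3.
have [u uP] := separable_seq x0 Xsep.
have [d_ge0 d0 dC d_tri] := dm.
have [rho [rho_gt0 rho_small]] : exists rho : nat -> R,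
    (forall k, 0 < rho k) /\ forall r, 0 < r -> exists k, rho k < r.
  exists (fun k => k.+1%:R^-1); split => [k|r r0]; first by rewrite invr_gt0.
  have [N _ /(_ N (leqnn N)) hN] := near_infty_natSinv_lt (PosNum r0).
  by exists N.
(* Restricting centres to a dense sequence and radii to the values of [rho] leaves countably many
   conditions. *)
pose I := ((nat * nat * nat) + (nat * nat * nat * nat * nat))%type.
pose Q (i : I) : set (X -> R) := match i with
  | inl (a, b, k) => strict_max_near d (u a) (u b) (rho k)
  | inr (a, b, a', b', k) =>
      separated_max d (u a) (u b) (u a') (u b') (rho k)
  end.
have [|f [fc fe fQ]] := @robustly_dense_bigcap_countable R X I Q e _ e0.
  case=> [[[a b] k]|[[[[a b] a'] b'] k]] /=.
    exact: strict_max_near_dense.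
  exact: separated_max_dense.
exists f; split => //; apply/seteqP; split => [g gI|_ ->]; last first.
  by split => //; exists idfun.
have near_u x (r : R) : 0 < r -> exists n, d (u n, x) < r.
  move=> r0; have [||n un] := uP [set y | d (x, y) < r].
  - by exists x => /=; rewrite (d0 x x).2.
  - apply/dtop => y /= xy; exists (r - d (x, y)); first by lra.
    by move=> z /= yz; have := d_tri x y z; lra.
  - by exists n; rewrite dC.
have dpos x y : x != y -> 0 < d (x, y).
  move=> xy; rewrite lt_neqAle d_ge0 andbT eq_sym.
  by apply: contra xy => /eqP /d0 ->.
apply/funext => x /=; apply/eqP; apply: contrapT => /negP gx.
(* If neither [p] nor [q] works, they are [x] and [g x] in some order, and [r] works. *)
have [y [yx ygx]] : exists y, y != x /\ y != g x.
  have [p [q [r [pq pr qr]]]] := X3.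
  have [h|] := pselect (p != x /\ p != g x); first by exists p.
  have [h _|] := pselect (q != x /\ q != g x); first by exists q.
  move=> /not_andP hq /not_andP hp; exists r.
  case: hq => /negP; rewrite negbK => /eqP hq;
  case: hp => /negP; rewrite negbK => /eqP hp;
  by split; subst; rewrite eq_sym // ; move: pq; rewrite eqxx.
pose m := Num.min (Num.min (d (x, g x)) (d (y, g x))) (d (x, y)).
have m0 : 0 < m by rewrite !lt_min !dpos // eq_sym.
have [mx my mxy] : [/\ m <= d (x, g x), m <= d (y, g x) & m <= d (x, y)].
  by rewrite /m !ge_min !lexx !orbT.
have m8 : 0 < m / 8 by lra.
have [s s0 gs] := perturb_small dm dtop x fc m8.
(* A local maximum within [rho k] of the sequence points is within [2 * rho k] of [(x, y)]. This is
   below [s], which forces [g a] close to [g x], and below m/4, which keeps [g a] off [a] and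
   [b]. *)
have [|k km] := rho_small (Num.min (s / 2) (m / 8)).
  by rewrite lt_min m8 andbT; lra.
move: km; rewrite lt_min => /andP[ks km].
have k0 := rho_gt0 k.
have [na una] := near_u x _ k0; have [nb unb] := near_u y _ k0.
have uab : u na <> u nb.
  move=> uab; rewrite -uab in unb.
  by have := d_tri x (u na) y; rewrite (dC x (u na)); lra.
have [a [b [r [uaa ubb r0 abmax]]]] :=
  strict_max_local_max dm dtop dp fc uab (fQ (inl (na, nb, k))).
have xa : d (x, a) < s /\ d (x, a) < m / 4.
  by have := d_tri x (u na) a; rewrite (dC x (u na)); lra.
have yb : d (y, b) < m / 4.
  by have := d_tri y (u nb) b; rewrite (dC y (u nb)); lra.
have gxa : d (g x, g a) < m / 8.
  apply: le_lt_trans (perturb_ge d f _) _; case: (gI) => _ ->; apply: gs; lra.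
have gab : a != b.
  apply/eqP => ab; rewrite -ab in yb.
  by have := d_tri x a y; rewrite (dC a y); lra.
have gaa : g a != a.
  apply/eqP => ga; rewrite ga in gxa.
  by have := d_tri x a (g x); rewrite (dC a (g x)); lra.
have gabb : g a != b.
  apply/eqP => ga; rewrite ga in gxa.
  by have := d_tri y b (g x); rewrite (dC b (g x)); lra.
have gagb : g a != g b.
  apply: contra gab => /eqP gE; case: (gI) => [[h gK _] _].
  by rewrite -(gK a) gE gK.
have [s1 s10 max1] := local_max_metric dm dtop fc r0 abmax.
have [s2 s20 max2] :=
  local_max_metric dm dtop fc r0 (local_max_iso gI abmax).
pose t := Num.min (Num.min (d (g a, a)) (d (g a, b)))
                  (Num.min (d (g a, g b)) (Num.min s1 s2)).
have t0 : 0 < t by rewrite !lt_min !dpos ?s10.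
have [ta tb tg ts1 ts2] : [/\ t <= d (g a, a), t <= d (g a, b),
    t <= d (g a, g b), t <= s1 & t <= s2].
  by rewrite /t !ge_min !lexx !orbT.
(* With [rho l] below t/6, centres near points [t] apart are more than [4 * rho l] apart, and each
   ball stays within t/3 of its point, inside the range of the local maxima. *)
have [|l lt] := rho_small (t / 6); first by lra.
have l0 := rho_gt0 l.
have [n1 un1] := near_u (g a) _ l0; have [n2 un2] := near_u (g b) _ l0.
have [n3 un3] := near_u a _ l0; have [n4 un4] := near_u b _ l0.
have far p q w v : d (p, w) < rho l -> d (q, v) < rho l ->
    t <= d (w, v) -> 3 * rho l < d (p, q).
  move=> pw qv twv; have := d_tri w p v; have := d_tri p q v.
  by rewrite (dC w p); lra.
have near p w z : d (p, w) < rho l -> d (p, z) <= rho l ->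
    d (w, z) <= t / 3.
  by move=> pw pz; have := d_tri w p z; rewrite (dC w p); lra.
have gE : perturb d f (g a, g b) = perturb d f (a, b) by case: gI.
(* Whichever product wins, its winning value is at most that of its own local maximum, which by
   isometry is the value at the pair in the losing product. *)
have [] := fQ (inr (n1, n2, n3, n4, l)) (far _ _ _ _ un1 un2 tg)
  (far _ _ _ _ un1 un3 ta) (far _ _ _ _ un1 un4 tb).
- move=> [x1 [y1 [ux1 uy1 /(_ a b (ltW un3) (ltW un4))]]].
  have := max2 x1 y1; rewrite gE => h1 h2.
  have := near _ _ _ un1 ux1; have := near _ _ _ un2 uy1 => h3 h4.
  have : perturb d f (x1, y1) <= perturb d f (a, b) by apply: h1; lra.
  lra.
- move=> [x1 [y1 [ux1 uy1 /(_ (g a) (g b) (ltW un1) (ltW un2))]]].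
  have := max1 x1 y1; rewrite gE => h1 h2.
  have := near _ _ _ un3 ux1; have := near _ _ _ un4 uy1 => h3 h4.
  have : perturb d f (x1, y1) <= perturb d f (a, b) by apply: h1; lra.
  lra.
Qed.

(** * Density for uniform convergence on compact sets *)

(** Uniform convergence on the whole space implies convergence on compact sets: otherwise functions
    outside [W] within 1/(n+1) of [h] would converge to [h]. *)
Lemma nbhs_family_compact (R : realType) (T : topologicalType)
    (h : {family compact, T -> R}) (W : set {family compact, T -> R}) :
  nbhs h W -> exists2 e : R, 0 < e &
    forall g : T -> R, (forall p, `|g p - h p| <= e) -> W g.
Proof.
move=> hW; apply: contrapT => nW.
have bad n : exists g : T -> R,
    (forall p, `|g p - h p| <= n.+1%:R^-1) /\ ~ W g.
  apply: contrapT => /forallNP gW; apply: nW; exists n.+1%:R^-1.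
    by rewrite invr_gt0.
  by move=> g gh; apply: contrapT => Wg; apply: (gW g).
have [g gP] := choice bad.
have : {family compact, g @ \oo --> (h : T -> R)}.
  apply/fam_cvgP => A _ P /uniform_nbhs[E [+ EP]].
  rewrite -entourage_ballE => -[e /= e0 eE].
  have [N _ hN] := near_infty_natSinv_lt (PosNum e0).
  exists N => // n /hN /= ne; apply: EP => p _; apply: eE => /=.
  by rewrite /ball /= distrC; apply: le_lt_trans ne; have [] := gP n.
move=> /(_ W hW)[N _ /(_ N (leqnn N))] /=.
by have [] := gP N.
Qed.

(* Density is relative to the subspace topology of Metr_c R X. *)
Theorem corollary1p9 (R : realType) (X : topologicalType)
    (Xlc : locally_compact [set: X]) (Xpolish : polish_space R X)
    (X3 : exists x y z : X, [/\ x != y, x != z & y != z]) :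
  dense [set d : set_type (Metr_c R X) | Iso (val d) = [set idfun]].
Proof.
move=> O [[d dM] Od] [W oW WO]; have [dm dtop dp] := set_mem dM.
have /nbhs_family_compact[e e0 eW] : nbhs (d : {family compact, X * X -> R}) W.
  by apply: open_nbhs_nbhs; split => //; rewrite -WO in Od.
(* The difference of two values of [f] enters the metric, hence half of [e]. *)
have e2 : 0 < e / 2 by lra.
have [f [fc fe fI]] := rigid_perturbation dm dtop dp Xpolish.1 X3 e2.
have fM : Metr_c R X (perturb d f).
  split; [exact: perturb_metric|exact: perturb_topology|exact: perturb_proper].
exists (exist (fun h => h \in Metr_c R X) _ (mem_set fM)); split => //.
rewrite -WO; apply: eW => p; rewrite /perturb addrC addKr normr_id.
apply: le_trans (ler_normB _ _) _.
by have := fe p.1; have := fe p.2; lra.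
Qed.
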